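(* Let $(a_n)_{n\ge 0}$ be a sequence of complex numbers such that the power series $$f(z)=\sum_{n=0}^\infty a_n z^n$$ is holomorphic in a neighborhood of $z=0$, and let $\mu,\lambda\in\mathbb{C}$. Then for all complex $z$ in a sufficiently small neighborhood of $0$, $$\sum_{n=0}^\infty z^n\left(\sum_{k=0}^n\binom{n}{k}\left\lfloor\frac{k}{2}\right\rfloor \mu^k\lambda^{n-k}a_k\right)=\frac{\mu z}{2(1-\lambda z)^2}\,f'\!\left(\frac{\mu z}{1-\lambda z}\right)-\frac14\,\frac{1}{1-\lambda z}\left(f\!\left(\frac{\mu z}{1-\lambda z}\right)-f\!\left(\frac{-\mu z}{1-\lambda z}\right)\right).$$
   Context: $\lfloor x\rfloor$ denotes the floor function. Convention: $0^0=1$. *)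

(* Defs.v *)
From Stdlib Require Import Reals.
From Coquelicot Require Import Coquelicot.
Open Scope C_scope.

(* For k <= n, [Binomial.C n k : R] is the usual binomial coefficient, [Nat.div]
   is floor division, and [Cpow] satisfies 0 ^ 0 = 1. *)
Definition binomial_floor_coeff (a : nat -> C) (mu lambda : C) (n : nat) : C :=
  sum_n (fun k : nat =>
           RtoC (Binomial.C n k) * RtoC (INR (k / 2)%nat)
           * mu ^ k * lambda ^ (n - k) * a k) n.

(* [f] is only constrained near 0, where it is the sum of the power series. *)
Definition holomorphic_pseries_near_0 (a : nat -> C) (f : C -> C) : Prop :=
  locally (RtoC 0) (fun z : C => is_pseries a z (f z) /\ ex_derive f z).

(* Main.v *)
Require Import Defs.
From Stdlib Require Import Reals Lra Lia.
From Coquelicot Require Import Coquelicot.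
Open Scope C_scope.

(** Write [w = mu z / (1 - lambda z)].  Two facts combine.

    The first is the generating function of the binomial transform: for every
    sequence [b] of at most geometric growth and every small [z],
    [sum_n z^n sum_(k <= n) C(n,k) mu^k lambda^(n-k) b_k
     = (1 - lambda z)^-1 sum_k b_k w^k].
    It comes from exchanging the two sums and applying the negative binomial
    series [sum_j C(k+j,k) x^j = (1 - x)^-(k+1)] at [x = lambda z].  The exchange
    is done on partial sums, where the region [k <= n <= N] is finite; the price
    is that each inner series is cut at [j <= N - k].  For [|x| <= 1/4] the cut
    costs at most [2^k 2^-(N-k)] ([negative_binomial_remainder]), and the growth
    bound on [b] turns this into a total error [O(2^-N)]
    ([is_series_binomial_transform]).

    The second is the sum of the series with [b_k = floor(k/2) a_k].  Since
    [floor(k/2) = k/2 - (1 - (-1)^k)/4], it splits into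
    [(1/2) sum_k k a_k w^k - (1/4) (f(w) - f(-w))]  ([is_series_floor_half]),
    and [sum_k k a_k w^k = w f'(w)] by termwise differentiation
    ([is_series_C_derive]).  The latter follows from the second-order estimate
    [|y^k - w^k - k w^(k-1) (y - w)| = O(|y - w|^2)] with a constant growing
    geometrically in [k]: on a small enough disc it can be summed against
    [|a_k|].

    Convergence of [f] at one nonzero point supplies the geometric bound on the
    coefficients ([pseries_coeff_bound]), hence all smallness conditions on [z]. *)

(** * Complex series and neighbourhoods *)

Lemma pow_n_Cpow (z : C) (k : nat) : @pow_n C_Ring z k = z ^ k.
Proof. induction k as [|k IH]; [reflexivity|]. simpl. rewrite IH. reflexivity. Qed.

Lemma is_pseries_C (a : nat -> C) (z l : C) :
  is_pseries a z l <-> is_series (fun k => a k * z ^ k) l.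
Proof.
  assert (E : forall k, scal (pow_n (z : C_Ring) k) (a k : C_NormedModule)
                        = a k * z ^ k).
  { intro k. rewrite pow_n_Cpow. apply Cmult_comm. }
  split; apply is_series_ext; intro k; rewrite E; reflexivity.
Qed.

(** Neighbourhoods in [C] are defined by squares; the estimates below are in
    terms of the modulus. *)
Lemma locally_C_iff (x : C) (P : C -> Prop) :
  locally x P <-> exists d : posreal, forall y, (Cmod (y - x) < d)%R -> P y.
Proof.
  split; intro H.
  - exact (locally_norm_le_locally (V := C_NormedModule) x P H).
  - exact (locally_le_locally_norm (V := C_NormedModule) x P H).
Qed.

Lemma Cmod_sum_n_le (u : nat -> C) (n : nat) :
  (Cmod (sum_n u n) <= sum_n (fun k => Cmod (u k)) n)%R.
Proof. exact (norm_sum_n_m (V := C_NormedModule) u 0 n). Qed.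

Lemma is_series_C_norm_le (u : nat -> C) (b : nat -> R) (l : C) (B : R) :
  (forall n, (Cmod (u n) <= b n)%R) ->
  is_series u l -> is_series b B -> (Cmod l <= B)%R.
Proof.
  intros Hb Hu HB.
  apply (is_lim_seq_le (fun n => norm (sum_n u n : C_NormedModule)) (sum_n b)
           (norm (l : C_NormedModule)) B).
  - intro n. apply Rle_trans with (1 := norm_sum_n_m u 0 n).
    apply sum_n_m_le. exact Hb.
  - apply filterlim_comp with (1 := Hu). apply filterlim_norm.
  - exact HB.
Qed.

Lemma is_series_half_pow (K : R) : is_series (fun n => K * (1 / 2) ^ n)%R (2 * K)%R.
Proof.
  replace (2 * K)%R with (scal K (/ (1 - 1 / 2)))%R
    by (unfold scal; simpl; unfold mult; simpl; field).
  apply (is_series_scal (V := R_NormedModule) K (fun n => (1 / 2) ^ n)%R).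
  apply is_series_geom. rewrite Rabs_pos_eq; lra.
Qed.

(** The partial sums at [z] are bounded by some [M], so each term, a difference
    of two of them, is bounded by [2 M]. *)
Lemma pseries_coeff_bound (a : nat -> C) (z l : C) :
  z <> 0 -> is_pseries a z l ->
  exists M A : R, (0 < A)%R /\ forall k, (Cmod (a k) <= M * A ^ k)%R.
Proof.
  intros Hz H. apply is_pseries_C in H.
  destruct (filterlim_bounded _ (ex_intro _ l H)) as [M HM].
  change (forall n, (Cmod (sum_n (fun k => a k * z ^ k)%C n) <= M)%R) in HM.
  exists (2 * M)%R, (/ Cmod z)%R.
  apply Cmod_gt_0 in Hz.
  split. { now apply Rinv_0_lt_compat. }
  intro k.
  assert (Ht : (Cmod (a k * z ^ k) <= 2 * M)%R).
  { destruct k as [|k].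
    - specialize (HM 0%nat). rewrite sum_O in HM.
      pose proof (Cmod_ge_0 (a 0%nat * z ^ 0)). lra.
    - pose proof (HM k) as H1. pose proof (HM (S k)) as H2.
      rewrite sum_Sn in H2.
      set (s := sum_n _ k) in *. change plus with Cplus in H2.
      replace (a (S k) * z ^ S k) with ((s + a (S k) * z ^ S k) + - s) by ring.
      eapply Rle_trans; [apply Cmod_triangle|]. rewrite Cmod_opp. lra. }
  rewrite Cmod_mult, Cmod_pow in Ht.
  rewrite pow_inv. apply Rle_div_r; [now apply pow_lt|exact Ht].
Qed.

(** * The truncated negative binomial series *)

Lemma binomial_bounds (n k : nat) :
  (k <= n)%nat -> (0 <= Binomial.C n k <= 2 ^ n)%R.
Proof.
  revert k. induction n as [|n IH]; intros k Hk.
  - replace k with 0%nat by lia. rewrite C_n_0. simpl; lra.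
  - destruct k as [|k].
    + rewrite C_n_0. pose proof (pow_R1_Rle 2 (S n) ltac:(lra)). lra.
    + destruct (Nat.eq_dec k n) as [->|Hkn].
      * rewrite C_n_n. pose proof (pow_R1_Rle 2 (S n) ltac:(lra)). lra.
      * rewrite <- pascal by lia.
        pose proof (IH k ltac:(lia)). pose proof (IH (S k) ltac:(lia)).
        simpl. lra.
Qed.

Definition negative_binomial_sum (x : C) (k m : nat) : C :=
  sum_n (fun j => RtoC (Binomial.C (k + j) k) * x ^ j) m.

(** Pascal's rule, summed: multiplying by [1 - x] lowers the order [k] by one, up
    to the boundary term of the truncation. *)
Lemma negative_binomial_partial_sum_rec (x : C) (k m : nat) :
  (1 - x) * negative_binomial_sum x (S k) m
  = negative_binomial_sum x k m
    - RtoC (Binomial.C (S k + m) (S k)) * x ^ S m.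
Proof.
  induction m as [|m IH].
  - unfold negative_binomial_sum. rewrite !sum_O, !Nat.add_0_r, !C_n_n. simpl. ring.
  - unfold negative_binomial_sum in *. rewrite !sum_Sn. change plus with Cplus.
    rewrite Cmult_plus_distr_l, IH.
    replace (S k + S m)%nat with (S (k + S m)) by lia.
    rewrite <- pascal by lia.
    replace (k + S m)%nat with (S k + m)%nat by lia.
    rewrite RtoC_plus, !Cpow_S. ring.
Qed.

Lemma Cmod_1_minus_ge (x : C) : (Cmod x <= 1 / 4)%R -> (3 / 4 <= Cmod (1 - x))%R.
Proof.
  intro Hx. pose proof (Cmod_triangle (1 - x) x) as H.
  replace (1 - x + x) with (RtoC 1) in H by ring. rewrite Cmod_1 in H. lra.
Qed.

Lemma Cmod_pos_neq (x : C) (c : R) : (0 < c)%R -> (c <= Cmod x)%R -> x <> 0.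
Proof. intros Hc H E. rewrite E, Cmod_0 in H. lra. Qed.

(** Induction on [k] along the recurrence above.  Dividing by [1 - x] costs a
    factor [4/3], and the boundary term is at most
    [2^(k+1+m) 4^-(m+1) = (1/2) 2^k 2^-m]; the bound closes because
    [(4/3) (1 + 1/2) = 2]. *)
Lemma negative_binomial_remainder (x : C) (k m : nat) :
  (Cmod x <= 1 / 4)%R ->
  (Cmod (/ (1 - x) ^ S k
         - negative_binomial_sum x k m)
   <= 2 ^ k * (1 / 2) ^ m)%R.
Proof.
  intro Hx. pose proof (Cmod_1_minus_ge x Hx) as H1.
  pose proof (Cmod_pos_neq (1 - x) (3 / 4) ltac:(lra) H1) as Hne.
  pose proof (Cmod_ge_0 x) as Hx0.
  assert (Hpow : forall n, (Cmod (x ^ n) <= (1 / 2) ^ n * (1 / 2) ^ n)%R).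
  { intro n. rewrite Cmod_pow, <- Rpow_mult_distr. apply pow_incr. lra. }
  assert (Hhalf : forall n, (0 < (1 / 2) ^ n)%R) by (intro; apply pow_lt; lra).
  (* Everything is compared after multiplication by 1 - x. *)
  assert (Hdiv : forall e c, (Cmod ((1 - x) * e) <= 3 / 4 * c)%R -> (Cmod e <= c)%R).
  { intros e c H. rewrite Cmod_mult in H. pose proof (Cmod_ge_0 e). nra. }
  induction k as [|k IH]; apply Hdiv.
  - assert (E : (1 - x) * (/ (1 - x) ^ 1
         - negative_binomial_sum x 0 m) = x ^ S m).
    { clear -Hne. unfold negative_binomial_sum. induction m as [|m IH].
      - rewrite sum_O, C_n_0. simpl. field. exact Hne.
      - rewrite sum_Sn, C_n_0. change plus with Cplus.
        set (P := sum_n _ m) in *. set (q := / (1 - x) ^ 1) in *.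
        transitivity ((1 - x) * (q - P) - (1 - x) * x ^ S m); [ring|].
        rewrite IH, (Cpow_S x (S m)). ring. }
    rewrite E. eapply Rle_trans; [apply Hpow|].
    pose proof (Hhalf m). assert ((1 / 2) ^ m <= 1)%R.
    { rewrite <- (pow1 m) at 2. apply pow_incr. lra. }
    simpl. nra.
  - replace ((1 - x) * (/ (1 - x) ^ S (S k)
         - negative_binomial_sum x (S k) m))
      with ((/ (1 - x) ^ S k - negative_binomial_sum x k m)
            + RtoC (Binomial.C (S k + m) (S k)) * x ^ S m).
    2:{ replace ((1 - x) * (/ (1 - x) ^ S (S k) - negative_binomial_sum x (S k) m))
          with ((1 - x) * / (1 - x) ^ S (S k) - (1 - x) * negative_binomial_sum x (S k) m)
          by ring.
        rewrite negative_binomial_partial_sum_rec.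
        rewrite (Cpow_S _ (S k)). field. split; [now apply Cpow_nz|exact Hne]. }
    eapply Rle_trans; [apply Cmod_triangle|].
    rewrite Cmod_mult, Cmod_R.
    destruct (binomial_bounds (S k + m) (S k) ltac:(lia)) as [Hb0 Hb].
    rewrite Rabs_pos_eq by exact Hb0.
    assert (Hp : (2 ^ (S k + m) * ((1 / 2) ^ S m * (1 / 2) ^ S m)
                  = 1 / 2 * (2 ^ k * (1 / 2) ^ m))%R).
    { rewrite pow_add. replace (2 ^ S k * 2 ^ m * ((1 / 2) ^ S m * (1 / 2) ^ S m))%R
        with (1 / 2 * (2 ^ k * (1 / 2) ^ m) * (2 ^ m * (1 / 2) ^ m))%R by (simpl; field).
      rewrite <- Rpow_mult_distr. replace (2 * (1 / 2))%R with 1%R by field.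
      rewrite pow1. ring. }
    assert (Hc : (Binomial.C (S k + m) (S k) * Cmod (x ^ S m)
                  <= 2 ^ (S k + m) * ((1 / 2) ^ S m * (1 / 2) ^ S m))%R).
    { apply Rmult_le_compat; auto. apply Cmod_ge_0. }
    rewrite Hp in Hc. simpl (2 ^ S k)%R. lra.
Qed.

(** * The generating function of a binomial transform *)

Lemma sum_n_triangle (G : AbelianMonoid) (u : nat -> nat -> G) (N : nat) :
  sum_n (fun n => sum_n (fun k => u n k) n) N
  = sum_n (fun k => sum_n (fun j => u (k + j)%nat k) (N - k)) N.
Proof.
  induction N as [|N IH].
  - rewrite !sum_O. reflexivity.
  - rewrite sum_Sn, IH, (sum_Sn (fun k => u (S N) k)), plus_assoc, <- sum_n_plus.
    rewrite (sum_Sn (fun k => sum_n _ (S N - k))).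
    replace (S N - S N)%nat with 0%nat by lia. rewrite sum_O, Nat.add_0_r.
    f_equal. apply sum_n_ext_loc. intros k Hk.
    replace (S N - k)%nat with (S (N - k)) by lia. rewrite sum_Sn.
    do 2 f_equal. lia.
Qed.

Lemma filterlim_half_pow_bound (d : nat -> C) (K : R) :
  (forall n, (Cmod (d n) <= K * (1 / 2) ^ n)%R) ->
  filterlim d eventually (locally (RtoC 0)).
Proof.
  intro H. apply (filterlim_locally_ball_norm (U := C_NormedModule)). intro eps.
  assert (HK : is_lim_seq (fun n => K * (1 / 2) ^ n)%R (K * 0)%R).
  { apply (is_lim_seq_scal_l _ K 0). apply is_lim_seq_geom.
    rewrite Rabs_pos_eq; lra. }
  rewrite Rmult_0_r in HK.
  apply is_lim_seq_spec in HK. destruct (HK eps) as [N HN].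
  exists N. intros n Hn.
  change (Cmod (d n - 0) < eps)%R.
  replace (d n - 0) with (d n) by ring.
  apply Rle_lt_trans with (1 := H n). specialize (HN n Hn).
  rewrite Rminus_0_r in HN. apply Rabs_def2 in HN. lra.
Qed.

(** The partial sums of the left series are those of the right one plus an error
    [d]: the truncation remainders of the negative binomial series of order [k]
    weighted by [b_k (mu z)^k].  Under [8 B |mu z| <= 1] the weight
    [B^k |mu z|^k 2^k] is at most [4^-k]: one factor [2^-k] restores [2^-N]
    from the remainder [2^-(N-k)], the other makes the sum over [k] bounded. *)
Lemma is_series_binomial_transform (b : nat -> C) (mu lambda z l : C) (M B : R) :
  (0 <= B)%R ->
  (forall k, (Cmod (b k) <= M * B ^ k)%R) ->
  (Cmod (lambda * z) <= 1 / 4)%R ->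
  (8 * B * Cmod (mu * z) <= 1)%R ->
  is_series (fun k => b k * (mu * z / (1 - lambda * z)) ^ k) l ->
  is_series (fun n => z ^ n *
               sum_n (fun k => RtoC (Binomial.C n k) * mu ^ k * lambda ^ (n - k) * b k) n)
            (/ (1 - lambda * z) * l).
Proof.
  intros HB0 Hb Hx Hy Hl.
  pose proof (Cmod_1_minus_ge _ Hx) as H1.
  set (x := lambda * z) in *. set (y := mu * z) in *.
  pose proof (Cmod_pos_neq (1 - x) (3 / 4) ltac:(lra) H1) as Hne.
  set (rem := fun k m => / (1 - x) ^ S k
         - negative_binomial_sum x k m).
  set (d := fun N => sum_n (fun k => - (b k * y ^ k * rem k (N - k)%nat)) N).
  assert (HT : forall N,
    sum_n (fun n => z ^ n *
      sum_n (fun k => RtoC (Binomial.C n k) * mu ^ k * lambda ^ (n - k) * b k) n) N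
    = / (1 - x) * sum_n (fun k => b k * (y / (1 - x)) ^ k) N + d N).
  { intro N.
    rewrite (sum_n_ext _ (fun n => sum_n (fun k =>
       z ^ n * (RtoC (Binomial.C n k) * mu ^ k * lambda ^ (n - k) * b k)) n)).
    2:{ intro n. symmetry. apply (sum_n_mult_l (K := C_Ring)). }
    rewrite (sum_n_triangle _ (fun n k =>
       z ^ n * (RtoC (Binomial.C n k) * mu ^ k * lambda ^ (n - k) * b k))).
    rewrite <- (sum_n_mult_l (K := C_Ring)). unfold d.
    rewrite <- (sum_n_plus (G := C_AbelianMonoid)).
    apply sum_n_ext. intro k.
    change plus with Cplus. change mult with Cmult.
    unfold rem.
    rewrite (sum_n_ext _ (fun j => (b k * y ^ k) * (RtoC (Binomial.C (k + j) k) * x ^ j))).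
    2:{ intro j. replace (k + j - k)%nat with j by lia. unfold x, y.
        rewrite Cpow_add_r, !Cpow_mult_l.
        match goal with |- ?u = ?v => change (@eq C u v) end. ring. }
    rewrite (sum_n_mult_l (K := C_Ring)). change mult with Cmult.
    change (b k * y ^ k * negative_binomial_sum x k (N - k)
      = / (1 - x) * (b k * (y / (1 - x)) ^ k)
        + - (b k * y ^ k * (/ (1 - x) ^ S k - negative_binomial_sum x k (N - k)))).
    unfold Cdiv. rewrite Cpow_mult_l, Cpow_inv, Cpow_S by exact Hne.
    field. split; [now apply Cpow_nz|exact Hne]. }
  assert (Hd : forall N, (Cmod (d N) <= 2 * M * (1 / 2) ^ N)%R).
  { intro N. unfold d.
    assert (HM : (0 <= M)%R).
    { specialize (Hb 0%nat). pose proof (Cmod_ge_0 (b 0%nat)). simpl in Hb. lra. }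
    eapply Rle_trans; [apply Cmod_sum_n_le|].
    apply Rle_trans with (sum_n (fun k => scal (M * (1 / 2) ^ N) ((1 / 2) ^ k)) N)%R.
    - apply sum_n_m_le. intro k. rewrite Cmod_opp, !Cmod_mult, Cmod_pow.
      assert (Hk : (Cmod (b k) * Cmod y ^ k * Cmod (rem k (N - k)%nat)
                   <= M * B ^ k * Cmod y ^ k * (2 ^ k * (1 / 2) ^ (N - k)))%R).
      { apply Rmult_le_compat.
        - apply Rmult_le_pos; [apply Cmod_ge_0|apply pow_le, Cmod_ge_0].
        - apply Cmod_ge_0.
        - apply Rmult_le_compat_r; [apply pow_le, Cmod_ge_0|apply Hb].
        - apply negative_binomial_remainder, Hx. }
      eapply Rle_trans; [exact Hk|].
      replace (M * B ^ k * Cmod y ^ k * (2 ^ k * (1 / 2) ^ (N - k)))%R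
        with (M * ((2 * B * Cmod y) ^ k * (1 / 2) ^ (N - k)))%R
        by (rewrite !Rpow_mult_distr; ring).
      change (scal (M * (1 / 2) ^ N) ((1 / 2) ^ k))%R with (M * (1 / 2) ^ N * (1 / 2) ^ k)%R.
      rewrite (Rmult_assoc M). apply Rmult_le_compat_l; [exact HM|].
      apply Rle_trans with ((1 / 2 * (1 / 2)) ^ k * (1 / 2) ^ (N - k))%R.
      + apply Rmult_le_compat_r; [apply pow_le; lra|]. apply pow_incr.
        pose proof (Cmod_ge_0 y). split; [|lra].
        apply Rmult_le_pos; [lra|assumption].
      + rewrite Rpow_mult_distr.
        replace ((1 / 2) ^ k * (1 / 2) ^ k * (1 / 2) ^ (N - k))%R
          with ((1 / 2) ^ k * (1 / 2) ^ (N - k) * (1 / 2) ^ k)%R by ring.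
        apply Rmult_le_compat_r; [apply pow_le; lra|].
        rewrite <- pow_add.
        (* The comparison of terms is needed for every k; beyond N, truncated
           subtraction leaves k + (N - k) = k >= N. *)
        replace (k + (N - k))%nat with (N + (k - N))%nat by lia.
        rewrite pow_add. rewrite <- (Rmult_1_r ((1 / 2) ^ N)) at 2.
        apply Rmult_le_compat_l; [apply pow_le; lra|].
        rewrite <- (pow1 (k - N)) at 2. apply pow_incr. lra.
    - rewrite (sum_n_scal_l (V := R_ModuleSpace)).
      change (M * (1 / 2) ^ N * sum_n (fun k => (1 / 2) ^ k) N <= 2 * M * (1 / 2) ^ N)%R.
      assert (Hg : (sum_n (fun k => (1 / 2) ^ k) N <= 2)%R).
      { rewrite sum_n_Reals, tech3 by lra.
        pose proof (pow_lt (1 / 2) (S N) ltac:(lra)). lra. }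
      pose proof (pow_le (1 / 2) N ltac:(lra)) as Hp.
      pose proof (Rmult_le_compat_l _ _ _ (Rmult_le_pos _ _ HM Hp) Hg). lra. }
  unfold is_series.
  apply filterlim_ext with
    (f := fun N => plus
       (scal (/ (1 - x)) (sum_n (fun k => b k * (y / (1 - x)) ^ k) N : C_NormedModule))
       (d N)).
  { intro N. symmetry. apply HT. }
  replace (/ (1 - x) * l) with (plus (scal (/ (1 - x)) (l : C_NormedModule)) (RtoC 0))
    by (apply Cplus_0_r).
  eapply filterlim_comp_2.
  - eapply filterlim_comp; [exact Hl|apply (filterlim_scal_r (V := C_NormedModule))].
  - apply filterlim_half_pow_bound with (1 := Hd).
  - apply (filterlim_plus (V := C_NormedModule)).
Qed.

(** * Termwise differentiation of a complex power series *)

Lemma INR_S_le_pow2 (k : nat) : (INR (S k) <= 2 ^ k)%R.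
Proof.
  induction k as [|k IH]; [simpl; lra|].
  rewrite S_INR. pose proof (pow_R1_Rle 2 k ltac:(lra)). simpl (2 ^ S k)%R. lra.
Qed.

(** The Taylor remainders [e_k] of [w^(k+1)] satisfy
    [e_(k+1) = y e_k + (k+1) w^k (y-w)^2].  The extra factor [r] on the left
    stands for the exponent [k - 1], which would be negative at [k = 0]. *)
Lemma Cpow_Taylor_bound (r : R) (w y : C) (k : nat) :
  (0 <= r)%R -> (Cmod w <= r)%R -> (Cmod y <= r)%R ->
  (r * Cmod (y ^ S k - w ^ S k - RtoC (INR (S k)) * w ^ k * (y - w))
   <= (4 * r) ^ k * (Cmod (y - w) * Cmod (y - w)))%R.
Proof.
  intros Hr Hw Hy. set (h := Cmod (y - w)).
  assert (Hh : (0 <= h)%R) by apply Cmod_ge_0.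
  induction k as [|k IH].
  - replace (y ^ 1 - w ^ 1 - RtoC (INR 1) * w ^ 0 * (y - w)) with (RtoC 0)
      by (simpl; ring).
    rewrite Cmod_0. simpl. nra.
  - set (e := y ^ S k - w ^ S k - RtoC (INR (S k)) * w ^ k * (y - w)) in *.
    replace (y ^ S (S k) - w ^ S (S k) - RtoC (INR (S (S k))) * w ^ S k * (y - w))
      with (y * e + RtoC (INR (S k)) * w ^ k * ((y - w) * (y - w))).
    2:{ unfold e. rewrite (S_INR (S k)), RtoC_plus, !Cpow_S. ring. }
    assert (H2 : (Cmod (RtoC (INR (S k)) * w ^ k * ((y - w) * (y - w)))
                  <= 2 ^ k * r ^ k * (h * h))%R).
    { rewrite !Cmod_mult, Cmod_R, Cmod_pow, Rabs_pos_eq by apply pos_INR.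
      apply Rmult_le_compat_r; [now apply Rmult_le_pos|].
      apply Rmult_le_compat; [apply pos_INR|apply pow_le, Cmod_ge_0|apply INR_S_le_pow2|].
      apply pow_incr. split; [apply Cmod_ge_0|exact Hw]. }
    assert (H3 : (2 ^ k * r ^ k * (h * h) <= (4 * r) ^ k * (h * h))%R).
    { apply Rmult_le_compat_r; [now apply Rmult_le_pos|].
      rewrite <- Rpow_mult_distr. apply pow_incr. lra. }
    apply Rle_trans with (r * (r * Cmod e + (4 * r) ^ k * (h * h)))%R.
    + apply Rmult_le_compat_l; [exact Hr|].
      eapply Rle_trans; [apply Cmod_triangle|].
      apply Rplus_le_compat; [|lra].
      rewrite Cmod_mult. apply Rmult_le_compat_r; [apply Cmod_ge_0|exact Hy].
    + assert (0 <= (4 * r) ^ k * (h * h))%R.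
      { apply Rmult_le_pos; [apply pow_le; lra|now apply Rmult_le_pos]. }
      simpl ((4 * r) ^ S k)%R. nra.
Qed.

Lemma is_derive_of_quadratic_bound (f : C -> C) (w D : C) (r K : R) :
  (Cmod w < r)%R ->
  (forall y, (Cmod y < r)%R ->
     (Cmod (f y - f w - D * (y - w)) <= K * (Cmod (y - w) * Cmod (y - w)))%R) ->
  is_derive f w D.
Proof.
  intros Hw HK. split. { apply (is_linear_scal_l (D : C_NormedModule)). }
  intros x Hx. apply (is_filter_lim_locally_unique (V := AbsRing_NormedModule C_AbsRing)) in Hx.
  subst x. intros eps.
  assert (HK1 : (0 < Rabs K + 1)%R) by (pose proof (Rabs_pos K); lra).
  assert (Hd : (0 < Rmin (r - Cmod w) (eps / (Rabs K + 1)))%R).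
  { apply Rmin_pos; [lra|]. apply Rdiv_lt_0_compat; [apply cond_pos|exact HK1]. }
  exists (mkposreal _ Hd).
  change (forall y : C,
    (Cmod (y - w) < Rmin (r - Cmod w) (eps / (Rabs K + 1)))%R ->
    (Cmod (f y - f w - (y - w) * D) <= eps * Cmod (y - w))%R).
  intros y Hy.
  pose proof (Rlt_le_trans _ _ _ Hy (Rmin_l _ _)) as Hy1.
  pose proof (Rlt_le_trans _ _ _ Hy (Rmin_r _ _)) as Hy2.
  apply Rlt_div_r in Hy2; [|exact HK1].
  rewrite (Cmult_comm (y - w)).
  assert (Hyr : (Cmod y < r)%R).
  { pose proof (Cmod_triangle (y - w) w) as H.
    replace (y - w + w) with y in H by ring. lra. }
  eapply Rle_trans; [apply (HK y Hyr)|].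
  rewrite <- Rmult_assoc. apply Rmult_le_compat_r; [apply Cmod_ge_0|].
  pose proof (Cmod_ge_0 (y - w)). pose proof (Rle_abs K). nra.
Qed.

(** The condition [8 A r <= 1] makes both the candidate derivative and the summed
    Taylor remainders dominated by geometric series of ratio [1/2]. *)
Lemma is_series_C_derive (a : nat -> C) (f : C -> C) (M A r : R) (w : C) :
  (0 < A)%R -> (forall k, (Cmod (a k) <= M * A ^ k)%R) ->
  (8 * A * r <= 1)%R ->
  (forall y, (Cmod y < r)%R -> is_pseries a y (f y)) ->
  (Cmod w < r)%R ->
  is_series (fun k => RtoC (INR k) * a k * w ^ k) (w * C_derive f w).
Proof.
  intros HA Ha HAr Hf Hw.
  pose proof (Cmod_ge_0 w) as Hw0.
  assert (HM : (0 <= M)%R).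
  { specialize (Ha 0%nat). pose proof (Cmod_ge_0 (a 0%nat)). simpl in Ha. lra. }
  assert (Hgeo : forall k, (A ^ S k * (4 * r) ^ k <= A * (1 / 2) ^ k)%R).
  { intro k. simpl (A ^ S k)%R. rewrite Rmult_assoc, <- Rpow_mult_distr.
    apply Rmult_le_compat_l; [lra|]. apply pow_incr. split; [nra|lra]. }
  set (u := fun k => RtoC (INR (S k)) * a (S k) * w ^ k).
  assert (Hu : ex_series (V := C_NormedModule) u).
  { apply (ex_series_le (V := C_CompleteNormedModule) u
             (fun k => M * A * (1 / 2) ^ k)%R); [|eexists; apply is_series_half_pow].
    intro k. change (Cmod (u k) <= M * A * (1 / 2) ^ k)%R. unfold u.
    rewrite !Cmod_mult, Cmod_R, Cmod_pow, Rabs_pos_eq by apply pos_INR.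
    apply Rle_trans with (2 ^ k * (M * A ^ S k) * r ^ k)%R.
    - apply Rmult_le_compat.
      + apply Rmult_le_pos; [apply pos_INR|apply Cmod_ge_0].
      + now apply pow_le.
      + apply Rmult_le_compat; [apply pos_INR|apply Cmod_ge_0|apply INR_S_le_pow2|apply Ha].
      + apply pow_incr. lra.
    - replace (2 ^ k * (M * A ^ S k) * r ^ k)%R with (M * (A ^ S k * (2 * r) ^ k))%R
        by (rewrite Rpow_mult_distr; ring).
      rewrite Rmult_assoc. apply Rmult_le_compat_l; [exact HM|].
      eapply Rle_trans; [|apply Hgeo].
      apply Rmult_le_compat_l; [apply pow_le; lra|]. apply pow_incr. lra. }
  destruct Hu as [D HD].
  assert (HfD : is_derive f w D).
  { apply is_derive_of_quadratic_bound with (r := r) (K := (2 * (M * A / r))%R); [exact Hw|].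
    intros y Hy.
    assert (Hdiff : is_series
              (fun k => a (S k) * (y ^ S k - w ^ S k - RtoC (INR (S k)) * w ^ k * (y - w)))
              (f y - f w - D * (y - w))).
    { pose proof (proj1 (is_pseries_C _ _ _) (Hf y Hy)) as Sy.
      pose proof (proj1 (is_pseries_C _ _ _) (Hf w Hw)) as Sw.
      pose proof (is_series_minus _ _ _ _ Sy Sw) as Syw.
      pose proof (is_series_scal (V := C_NormedModule) (y - w) _ _ HD) as SD.
      assert (Sd : is_series (fun k => plus (a (S k) * y ^ S k) (opp (a (S k) * w ^ S k)))
                             (plus (f y) (opp (f w)))).
      { apply (is_series_incr_1 (V := C_NormedModule)
                 (fun k => plus (a k * y ^ k : C_NormedModule) (opp (a k * w ^ k)))).
        replace (plus _ _) with (plus (f y : C_NormedModule) (opp (f w))); [exact Syw|].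
        match goal with |- ?u = ?v => change (@eq C u v) end.
        change (f y + - f w = (f y + - f w) + (a 0%nat * y ^ 0 + - (a 0%nat * w ^ 0))).
        simpl. ring. }
      pose proof (is_series_minus _ _ _ _ Sd SD) as Sdiff.
      replace (f y - f w - D * (y - w))
        with (plus (plus (f y : C_NormedModule) (opp (f w))) (opp (scal (y - w) D))).
      2:{ change (f y + - f w + - ((y - w) * D) = f y - f w - D * (y - w)). ring. }
      apply is_series_ext with (2 := Sdiff). intro k. unfold u.
      change (a (S k) * y ^ S k + - (a (S k) * w ^ S k)
        + - ((y - w) * (RtoC (INR (S k)) * a (S k) * w ^ k))
       = a (S k) * (y ^ S k - w ^ S k
            - RtoC (INR (S k)) * w ^ k * (y - w))). ring. }
    set (h := Cmod (y - w)).
    assert (Hh : (0 <= h * h)%R) by (apply Rmult_le_pos; apply Cmod_ge_0).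
    replace (2 * (M * A / r) * (h * h))%R with (2 * (M * A / r * (h * h)))%R by ring.
    refine (is_series_C_norm_le _ _ _ _ _ Hdiff (is_series_half_pow _)).
    intro k. rewrite Cmod_mult.
    apply Rmult_le_reg_l with r; [lra|].
    pose proof (Cpow_Taylor_bound r w y k ltac:(lra) ltac:(lra) ltac:(lra)) as HT.
    fold h in HT. set (e := Cmod (_ - _ - _)) in *.
    assert (He : (0 <= e)%R) by apply Cmod_ge_0.
    apply Rle_trans with ((M * A ^ S k) * ((4 * r) ^ k * (h * h)))%R.
    - replace (r * (Cmod (a (S k)) * e))%R with (Cmod (a (S k)) * (r * e))%R by ring.
      apply Rmult_le_compat; [apply Cmod_ge_0|apply Rmult_le_pos; lra|apply Ha|exact HT].
    - replace (r * (M * A / r * (h * h) * (1 / 2) ^ k))%R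
        with (M * (h * h) * (A * (1 / 2) ^ k))%R by (field; lra).
      replace (M * A ^ S k * ((4 * r) ^ k * (h * h)))%R
        with (M * (h * h) * (A ^ S k * (4 * r) ^ k))%R by ring.
      apply Rmult_le_compat_l; [now apply Rmult_le_pos|apply Hgeo]. }
  rewrite (is_C_derive_unique _ _ _ HfD).
  apply (is_series_decr_1 (V := C_NormedModule)).
  replace (plus _ _) with (scal (w : C_Ring) (D : C_NormedModule)).
  2:{ match goal with |- ?u = ?v => change (@eq C u v) end.
      change (w * D = w * D + - (RtoC 0 * a 0%nat * w ^ 0)). ring. }
  apply is_series_ext with (2 := is_series_scal (V := C_NormedModule) w _ _ HD).
  intro k. unfold u.
  change (w * (RtoC (INR (S k)) * a (S k) * w ^ k)
          = RtoC (INR (S k)) * a (S k) * w ^ S k).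
  rewrite Cpow_S. ring.
Qed.

(** * The weights floor(k/2) and the conclusion *)

Lemma INR_half (k : nat) :
  RtoC (INR (k / 2)) = / 2 * RtoC (INR k) - / 4 * (1 - (- (1)) ^ k).
Proof.
  assert (H : forall j, (- (1)) ^ (2 * j) = RtoC 1).
  { intro j. rewrite Cpow_mult_r. replace ((- (1)) ^ 2) with (RtoC 1) by (simpl; ring).
    apply Cpow_1_l. }
  destruct (Nat.Even_or_Odd k) as [[j ->]|[j ->]].
  - rewrite Nat.mul_comm, Nat.div_mul, Nat.mul_comm, H, mult_INR, RtoC_mult by lia.
    simpl (INR 2). rewrite RtoC_plus. field.
  - replace ((2 * j + 1) / 2)%nat with j.
    2:{ rewrite Nat.mul_comm, Nat.div_add_l by lia. simpl. lia. }
    rewrite plus_INR, mult_INR, RtoC_plus, RtoC_mult, Cpow_add_r, H.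
    simpl. rewrite RtoC_plus. field.
Qed.

Lemma is_series_floor_half (a : nat -> C) (w l l' D : C) :
  is_pseries a w l -> is_pseries a (- w) l' ->
  is_series (fun k => RtoC (INR k) * a k * w ^ k) D ->
  is_series (fun k => (RtoC (INR (k / 2)) * a k) * w ^ k)
            (/ 2 * D - / 4 * (l - l')).
Proof.
  intros Hl Hl' HD. apply is_pseries_C in Hl, Hl'.
  pose proof (is_series_minus _ _ _ _ Hl Hl') as Hm.
  apply (is_series_scal (V := C_NormedModule) (/ 4)) in Hm.
  apply (is_series_scal (V := C_NormedModule) (/ 2)) in HD.
  apply is_series_ext with (2 := is_series_minus _ _ _ _ HD Hm). intro k.
  change (/ 2 * (RtoC (INR k) * a k * w ^ k) + - (/ 4 * (a k * w ^ k + - (a k * (- w) ^ k)))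
          = RtoC (INR (k / 2)) * a k * w ^ k).
  replace (- w) with (- (1) * w) by ring.
  rewrite INR_half, Cpow_mult_l. ring.
Qed.

Theorem theorem1 (a : nat -> C) (f : C -> C) (mu lambda : C)
    (hf : holomorphic_pseries_near_0 a f) :
  locally (RtoC 0) (fun z : C =>
    is_series (fun n : nat => z ^ n * binomial_floor_coeff a mu lambda n)
      (mu * z / (2 * (1 - lambda * z) ^ 2)
         * C_derive f (mu * z / (1 - lambda * z))
       - / 4 * (/ (1 - lambda * z))
         * (f (mu * z / (1 - lambda * z)) - f (- mu * z / (1 - lambda * z))))).
Proof.
  apply locally_C_iff in hf. destruct hf as [d hf].
  pose proof (cond_pos d) as Hd.
  assert (Hf : forall y, (Cmod y < d)%R -> is_pseries a y (f y)).
  { intros y Hy. apply (hf y). replace (y - 0) with y by ring. exact Hy. }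
  destruct (pseries_coeff_bound a (RtoC (d / 2)) (f (RtoC (d / 2)))) as (M & A & HA & Ha).
  { apply Cmod_gt_0. rewrite Cmod_R, Rabs_pos_eq; lra. }
  { apply Hf. rewrite Cmod_R, Rabs_pos_eq; lra. }
  (* r: radius on which f can be differentiated termwise. *)
  set (r := Rmin d (/ (8 * A))).
  assert (Hr : (0 < r)%R) by (apply Rmin_pos; [lra|apply Rinv_0_lt_compat; lra]).
  assert (Hrd : (r <= d)%R) by apply Rmin_l.
  assert (HrA : (8 * A * r <= 1)%R).
  { rewrite <- (Rinv_r (8 * A)) by lra. apply Rmult_le_compat_l; [lra|apply Rmin_r]. }
  (* c bounds |lambda z| and |mu z|; then |w| <= (4/3) c < r, and c <= r/2
     gives 8 (2 A) c <= 1, the growth rate of floor(k/2) a_k being 2 A. *)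
  set (c := Rmin (1 / 4) (r / 2)).
  assert (Hc : (0 < c)%R) by (apply Rmin_pos; lra).
  assert (Hc4 : (c <= 1 / 4)%R) by apply Rmin_l.
  assert (Hcr : (c <= r / 2)%R) by apply Rmin_r.
  pose proof (Cmod_ge_0 lambda) as Hl0. pose proof (Cmod_ge_0 mu) as Hm0.
  assert (Hdelta : (0 < c / (1 + Cmod lambda + Cmod mu))%R)
    by (apply Rdiv_lt_0_compat; lra).
  apply locally_C_iff. exists (mkposreal _ Hdelta). simpl. intros z Hz.
  replace (z - 0) with z in Hz by ring.
  apply Rlt_div_r in Hz; [|lra]. pose proof (Cmod_ge_0 z) as Hz0.
  assert (Hlz : (Cmod (lambda * z) <= c)%R) by (rewrite Cmod_mult; nra).
  assert (Hmz : (Cmod (mu * z) <= c)%R) by (rewrite Cmod_mult; nra).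
  pose proof (Cmod_1_minus_ge (lambda * z) ltac:(lra)) as H1.
  pose proof (Cmod_pos_neq (1 - lambda * z) (3 / 4) ltac:(lra) H1) as Hne.
  set (w := mu * z / (1 - lambda * z)).
  assert (Hw : (Cmod w < r)%R).
  { unfold w. rewrite Cmod_div by exact Hne. apply Rlt_div_l; nra. }
  replace (- mu * z / (1 - lambda * z)) with (- w) by (unfold w; field; exact Hne).
  assert (HS : is_series (fun k => (RtoC (INR (k / 2)) * a k) * w ^ k)
                 (/ 2 * (w * C_derive f w) - / 4 * (f w - f (- w)))).
  { apply is_series_floor_half.
    - apply Hf. lra.
    - apply Hf. rewrite Cmod_opp. lra.
    - apply is_series_C_derive with (M := M) (A := A) (r := r); auto.
      intros y Hy. apply Hf. lra. }
  apply (is_series_binomial_transform _ mu lambda z _ M (2 * A)) in HS; [|lra| |lra|nra].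
  2:{ intro k. rewrite Cmod_mult, Cmod_R, Rabs_pos_eq by apply pos_INR.
      rewrite Rpow_mult_distr.
      replace (M * (2 ^ k * A ^ k))%R with (2 ^ k * (M * A ^ k))%R by ring.
      apply Rmult_le_compat; [apply pos_INR|apply Cmod_ge_0| |apply Ha].
      eapply Rle_trans; [|apply INR_S_le_pow2]. apply le_INR.
      pose proof (Nat.Div0.div_le_upper_bound k 2 k). lia. }
  replace (_ - _) with (/ (1 - lambda * z) * (/ 2 * (w * C_derive f w) - / 4 * (f w - f (- w)))).
  2:{ generalize (C_derive f w) (f w) (f (- w)). intros D l l'. unfold w.
      field. exact Hne. }
  apply is_series_ext with (2 := HS). intro n. unfold binomial_floor_coeff.
  f_equal. apply sum_n_ext. intro k.
  match goal with |- ?u = ?v => change (@eq C u v) end. ring.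
Qed.
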